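(* For every graph $G$, $\alpha^\circ(G)\le \chi_c(G)$.
   Context: All graphs are finite, undirected and simple. The length of a cycle is its number of vertices. Circular altitude. A circular ordering $\sigma$ of the vertex set $V(G)$ of a graph $G$ is a one-to-one assignment of $V(G)$ to the vertices of a directed cycle. A cycle $u_1,u_2,\ldots,u_n$ of $G$ is monotonic for $\sigma$ if $u_1,\ldots,u_n,u_1$ appear in this circular order in $\sigma$. The circular altitude $\alpha^\circ(G)$ is the largest $k$ such that every circular ordering of $V(G)$ contains a monotonic cycle of length at least $k$. For this definition edges are considered as monotonic cycles of length two, so the circular altitude is at least $2$ for any graph with at least one edge. Circular chromatic number. For positive integers $p$ and $q$, a colouring $c:V(G)\to\{1,\ldots,p\}$ of $G$ is called a $(p,q)$-colouring if $q\le |c(x)-c(y)|\le p-q$ for all adjacent vertices $x$ and $y$. The circular chromatic number of $G$ is $\chi_c(G)=\inf\{p/q : \text{there is a }(p,q)\text{-colouring of }G\}$. *)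

(* Defs.v *)
From mathcomp Require Import all_boot all_order all_algebra.
From mathcomp Require Import boolp classical_sets reals.

Set Implicit Arguments.
Unset Strict Implicit.
Unset Printing Implicit Defensive.

Import Order.TTheory GRing.Theory Num.Theory.

(* A finite simple graph is a symmetric irreflexive [e : rel T] on a finType. *)

(* The directed cycle is 'I_#|T|, with arcs i -> i + 1 modulo #|T|. *)
Definition circular_ordering (T : finType) (sigma : T -> 'I_#|T|) : Prop :=
  bijective sigma.

(* Number of arcs traversed when going from x forward to y. *)
Definition forward_dist (T : finType) (sigma : T -> 'I_#|T|) (x y : T) : nat :=
  ((sigma y + #|T| - sigma x) %% #|T|)%N.

(* A single turn around the directed cycle starting at the first vertex of s
   meets the vertices of s in the order in which s lists them. *)
Definition in_circular_order (T : finType) (sigma : T -> 'I_#|T|) (s : seq T) :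
    bool :=
  if s is x :: _ then sorted ltn [seq forward_dist sigma x y | y <- s]
  else true.

(* With size s = 2 this says that s lists the two ends of an edge, so edges are
   cycles of length two. *)
Definition graph_cycle (T : finType) (e : rel T) (s : seq T) : bool :=
  (1 < size s)%N && ucycleb e s.

Definition monotonic_cycle (T : finType) (e : rel T) (sigma : T -> 'I_#|T|)
    (s : seq T) : bool :=
  graph_cycle e s && in_circular_order sigma s.

Definition forces_monotonic_cycle (T : finType) (e : rel T) (k : nat) : Prop :=
  forall sigma : T -> 'I_#|T|, circular_ordering sigma ->
    exists2 s : seq T, monotonic_cycle e sigma s & (k <= size s)%N.

(* The bound k <= #|T| loses nothing (see [circular_altitude_max]). An edgeless
   graph has no monotonic cycle at all, and gets circular altitude 0. *)
Definition circular_altitude (T : finType) (e : rel T) : nat :=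
  \max_(k < #|T|.+1 | `[< forces_monotonic_cycle e k >]) k.

Lemma circular_altitude_max (T : finType) (e : rel T) (k : nat) :
  forces_monotonic_cycle e k -> (k <= circular_altitude e)%N.
Proof.
move=> hk.
have lek : (k < #|T|.+1)%N.
  have [s /andP[/andP[_ /andP[_ us]] _] ks] := hk _ (@enum_rank_bij T).
  by rewrite ltnS (leq_trans ks)// -(card_uniqP us) max_card.
rewrite /circular_altitude (bigD1 (Ordinal lek)) ?leq_maxl //.
exact/asboolP.
Qed.

Lemma circular_altitude_forces (T : finType) (e : rel T) (x y : T) :
  symmetric e -> irreflexive e -> e x y ->
  forces_monotonic_cycle e (circular_altitude e).
Proof.
move=> esym eirr exy.
have h0 : forces_monotonic_cycle e 0.
  move=> sigma /bij_inj sinj; exists [:: x; y] => //.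
  have xy : x != y by apply/eqP => E; rewrite E eirr in exy.
  rewrite /monotonic_cycle /graph_cycle /ucycleb /= inE xy exy esym exy /=.
  rewrite andbT /forward_dist addKn modnn lt0n.
  apply: contra xy => /eqP h; apply/eqP/sinj/val_inj => /=.
  have : (sigma y + #|T| = sigma x %[mod #|T|])%N.
    have sx : (sigma x <= sigma y + #|T|)%N.
      by rewrite (leq_trans (ltnW (ltn_ord _))) ?leq_addl.
    by rewrite -{1}(subnK sx) -modnDml h.
  by rewrite modnDr !modn_small.
rewrite /circular_altitude.
by apply: (big_ind (forces_monotonic_cycle e)) => // [a b ha hb|i /asboolP//];
  case: leqP.
Qed.

(* The inequalities are stated in int, so that p - q is not truncated. *)
Definition pq_colouring (T : finType) (e : rel T) (p q : nat) (c : T -> nat) :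
    Prop :=
  (forall x, (1 <= c x <= p)%N) /\
  (forall x y, e x y ->
     (q%:Z <= `|(c x)%:Z - (c y)%:Z| <= p%:Z - q%:Z)%R).

(* q may exceed p, which only matters for edgeless graphs: their infimum is 0. *)
Definition circular_chromatic_number (R : realType) (T : finType) (e : rel T) :
    R :=
  inf [set r : R | exists p q : nat, [/\ (0 < p)%N, (0 < q)%N,
         exists c : T -> nat, pq_colouring e p q c & r = (p%:R / q%:R)%R]]%classic.

(* Main.v *)
(** Given a (p,q)-colouring, order the vertices circularly by non-decreasing
    colour. Along a monotonic cycle of length n the colours go around Z/p exactly
    once, and each of the n edges advances by at least q; hence n q <= p. *)

Require Import Defs.
From mathcomp Require Import all_boot all_order all_algebra.
From mathcomp Require Import boolp classical_sets reals.
From mathcomp Require Import zify.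

Import Order.TTheory GRing.Theory Num.Theory.

(** Positions in the enumeration sorted by [c] serve as [sigma]; ties between equal colours may be
    broken either way. *)
Lemma exists_sorting_bijection (T : finType) (c : T -> nat) :
  exists2 sigma : T -> 'I_#|T|, bijective sigma &
    forall x y, (sigma x <= sigma y)%N -> (c x <= c y)%N.
Proof.
pose r := relpre c leq; pose s := sort r (enum T).
have ms x : x \in s by rewrite mem_sort mem_enum.
have lts x : (index x s < #|T|)%N by rewrite cardE -(size_sort r) index_mem.
exists (fun x => Ordinal (lts x)).
  apply: inj_card_bij; last by rewrite card_ord.
  by move=> x y [] /index_inj; apply.
move=> x y /= lexy.
have rtr : transitive r by move=> a b d; apply: leq_trans.
have rrefl : reflexive r by move=> a; apply: leqnn.
have srt : sorted r s by apply: sort_sorted => a b; apply: leq_total.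
have := sorted_leq_nth rtr rrefl x srt (index x s) (index y s).
by rewrite !inE !index_mem !ms !nth_index //; apply.
Qed.

Lemma path_leq_last (T : Type) (r : rel T) (f : T -> nat) (q : nat) x s :
  (forall y z, r y z -> (f y + q <= f z)%N) -> path r x s ->
  (f x + size s * q <= f (last x s))%N.
Proof.
move=> rf; elim: s x => [|y s IHs] x /=; first by rewrite mul0n addn0.
case/andP=> /rf fxy /IHs; apply: leq_trans.
by rewrite mulSn addnA leq_add2r.
Qed.

(** Trades the modulus for a case split, which [lia] can handle. *)
Lemma forward_distE (T : finType) (sigma : T -> 'I_#|T|) (x y : T) :
  forward_dist sigma x y =
    (if sigma x <= sigma y then sigma y - sigma x
     else sigma y + #|T| - sigma x)%N.
Proof.
have lx := ltn_ord (sigma x); have ly := ltn_ord (sigma y).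
rewrite /forward_dist; case: leqP => xy; last by rewrite modn_small; lia.
by rewrite -addnBAC // modnDr modn_small; lia.
Qed.

Lemma monotonic_cycle_size (T : finType) (e : rel T) (p q : nat) (c : T -> nat)
    (sigma : T -> 'I_#|T|) (s : seq T) :
  pq_colouring e p q c ->
  (forall x y, (sigma x <= sigma y)%N -> (c x <= c y)%N) ->
  monotonic_cycle e sigma s -> (size s * q <= p)%N.
Proof.
move=> [cb ce] cmono; case: s => [|x s] /andP[/andP[_ /andP[cyc _]] ord] //.
move: cyc; rewrite /= rcons_path => /andP[pe elast].
(* Colours unrolled from x: one full turn p is added past the origin of sigma. *)
pose C y := (if sigma x <= sigma y then c y else c y + p)%N.
pose d := forward_dist sigma x.
pose r := [rel y z | e y z && (d y < d z)%N].
(* On the same side of the origin, [c y <= c z], so the edge gives a gap of at least [q]. If only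
   [z] is past it, the gap [c z + p - c y] is at least [q] since colours of adjacent vertices differ
   by at most [p - q]. *)
have rC y z : r y z -> (C y + q <= C z)%N.
  move=> /andP[/ce eyz]; rewrite /d !forward_distE /C.
  have := cb y; have := cb z; have := cmono y z.
  have := ltn_ord (sigma y); have := ltn_ord (sigma z).
  have := ltn_ord (sigma x).
  by case: (leqP (sigma x) (sigma y)); case: (leqP (sigma x) (sigma z)); lia.
have pr : path r x s.
  by rewrite path_relI pe; move: ord; rewrite /= path_map.
(* The closing edge supplies the last [q]: on either side of the origin it forces
   [C (last x s) <= c x + p - q]. *)
have := path_leq_last _ r C q x s rC pr.
have := ce _ _ elast; have := cb x; have := cmono (last x s) x.
by rewrite /C leqnn mulSn; case: (leqP (sigma x) (sigma (last x s))); lia.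
Qed.

(** Distinct colours for all vertices; the extra colour keeps [p] positive even for empty [T]. *)
Lemma exists_pq_colouring (T : finType) (e : rel T) :
  irreflexive e -> exists c, pq_colouring e #|T|.+1 1 c.
Proof.
move=> eirr; exists (fun x => (enum_rank x).+1); split=> [x | x y exy].
  exact: leqW.
have : (enum_rank x != enum_rank y :> nat).
  by apply: contraTneq exy => /val_inj/enum_rank_inj ->; rewrite eirr.
move: (enum_rank x) (enum_rank y) => [i +] [j +] /=; set n := #|_|; lia.
Qed.

Lemma circular_altitude_pq (T : finType) (e : rel T) (p q : nat) c :
  pq_colouring e p q c -> (circular_altitude e * q <= p)%N.
Proof.
move=> pqc; have [sigma sbij smono] := exists_sorting_bijection _ c.
(* The bound holds for 0 and passes to maxima, so it suffices to treat each forced [k]. *)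
rewrite /circular_altitude; apply: (big_ind (fun k => k * q <= p)%N) => //.
  by move=> a b ha hb; rewrite maxnMl geq_max ha.
move=> k /asboolP/(_ _ sbij)[s smon ks].
apply: leq_trans (leq_mul ks (leqnn q)) _.
exact: (monotonic_cycle_size _ e p q c sigma).
Qed.

Theorem theorem1p3 (R : realType) (T : finType) (e : rel T)
    (esym : symmetric e) (eirr : irreflexive e) :
  ((circular_altitude e)%:R <= circular_chromatic_number R e)%R.
Proof.
(* A lower bound is compared with [inf] only on a nonempty set, hence the first goal. *)
apply: lb_le_inf.
  have [c pqc] := exists_pq_colouring T e eirr.
  by exists (#|T|.+1%:R / 1%:R)%R, #|T|.+1, 1; split=> //; exists c.
move=> _ [p [q [_ q0 [c pqc ->]]]].
rewrite ler_pdivlMr ?ltr0n // -natrM ler_nat.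
exact: circular_altitude_pq pqc.
Qed.
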